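(* Let $V$ be a vertex ring with vacuum $\mathbf{1}$ and canonical Hasse--Schmidt derivation $\underline{D}=(\mathrm{Id}_V,D_1,D_2,\dots)$. Then for all $u\in V$ and all $m\ge 1$: (a) $D_m\mathbf{1}=0$; (b) $Y(D_m(u),z)=\delta_z^{(m)}Y(u,z)$; (c) $[D_m,Y(u,z)]=\sum_{i=1}^m \delta_z^{(i)}Y(u,z)\,D_{m-i}$.
   Context: A vertex ring is an additive abelian group $V$ with biadditive products $(u,v)\mapsto u(n)v$ for all $n\in\mathbf{Z}$ and a distinguished element $\mathbf{1}\in V$ (the vacuum) such that for all $u,v,w\in V$: (a) there is an integer $n_0(u,v)\ge 0$ with $u(n)v=0$ for all $n\ge n_0$; (b) $u(-1)\mathbf{1}=u$ and $u(n)\mathbf{1}=0$ for $n\ge 0$; (c) for all $r,s,t\in\mathbf{Z}$, $\sum_{i\ge 0}\binom{r}{i}(u(t+i)v)(r+s-i)w=\sum_{i\ge 0}(-1)^i\binom{t}{i}\{u(r+t-i)v(s+i)w-(-1)^t v(s+t-i)u(r+i)w\}$. Here $\binom{m}{n}=m(m-1)\cdots(m-n+1)/n!$ for $m\in\mathbf{Z}$, $n\ge 1$, and $\binom{m}{0}=1$. We regard $u(n)$ as an element of $\mathrm{End}(V)$ (additive endomorphisms) and set $Y(u,z):=\sum_{n\in\mathbf{Z}}u(n)z^{-n-1}\in \mathrm{End}(V)[[z,z^{-1}]]$. The canonical Hasse--Schmidt derivation of $V$ is the sequence $D_m\in\mathrm{End}(V)$, $D_m(u):=u(-m-1)\mathbf{1}$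 ($m\ge 0$), so $D_0=\mathrm{Id}_V$. For a series $a(z)=\sum_n a(n)z^{-n-1}\in\mathrm{End}(V)[[z,z^{-1}]]$ and $i\ge0$, $\delta_z^{(i)}a(z)$ denotes ''$\frac{1}{i!}\partial_z^i a(z)$'', i.e. $\delta_z^{(i)}a(z):=\sum_n\binom{-n-1}{i}a(n)z^{-n-i-1}=(-1)^i\sum_n\binom{n}{i}a(n-i)z^{-n-1}$. Commutators and compositions of an endomorphism with a series are taken coefficientwise. *)

(* Defs.v *)
From HB Require Import structures.
From mathcomp Require Import all_boot all_order all_algebra.
From mathcomp Require Import boolp classical_sets functions fsbigop.

Set Implicit Arguments.
Unset Strict Implicit.
Unset Printing Implicit Defensive.

Import GRing.Theory.
Local Open Scope ring_scope.

(* The division is exact: n! divides any product of n consecutive integers. *)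
Definition binz (m : int) (n : nat) : int :=
  ((\prod_(i < n) (m - i%:Z)) %/ (n`!)%:Z)%Z.

(* MathComp has the type of additive endomorphisms but no ring structure on   *)
(* it. Classical axioms make equality in endo V extensional (endoP).          *)
Definition endo (V : zmodType) : Type := {additive V -> V}.

Section EndoRing.
Variable V : zmodType.
Implicit Types f g h : endo V.

Lemma endoP f g : f =1 g -> f = g.
Proof.
case: f g => [f [[ff]]] [g [[gg]]] /= fg.
have {}fg : f = g by apply: funext => x; exact: fg.
by subst g; rewrite (Prop_irrelevance ff gg).
Qed.

HB.instance Definition _ := gen_eqMixin (endo V).
HB.instance Definition _ := gen_choiceMixin (endo V).

Definition endo_zero : endo V := (\0 : V -> V).
Definition endo_add f g : endo V := f \+ g.
Definition endo_opp f : endo V := \- f.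
Definition endo_one : endo V := idfun.
Definition endo_mul f g : endo V := f \o g.

Fact endo_addA : associative endo_add.
Proof. by move=> f g h; apply: endoP => x; apply: addrA. Qed.
Fact endo_addC : commutative endo_add.
Proof. by move=> f g; apply: endoP => x; apply: addrC. Qed.
Fact endo_add0 : left_id endo_zero endo_add.
Proof. by move=> f; apply: endoP => x; apply: add0r. Qed.
Fact endo_addN : left_inverse endo_zero endo_opp endo_add.
Proof. by move=> f; apply: endoP => x; apply: addNr. Qed.

HB.instance Definition _ :=
  GRing.isZmodule.Build (endo V) endo_addA endo_addC endo_add0 endo_addN.

Fact endo_mulA : associative endo_mul.
Proof. by move=> f g h; apply: endoP. Qed.
Fact endo_mul1l : left_id endo_one endo_mul.
Proof. by move=> f; apply: endoP. Qed.
Fact endo_mul1r : right_id endo_one endo_mul.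
Proof. by move=> f; apply: endoP. Qed.
Fact endo_mulDl : left_distributive endo_mul endo_add.
Proof. by move=> f g h; apply: endoP. Qed.
Fact endo_mulDr : right_distributive endo_mul endo_add.
Proof. by move=> f g h; apply: endoP => x; apply: (raddfD f). Qed.

(* Not an nzRingType, since V may be trivial. *)
HB.instance Definition _ := GRing.Zmodule_isPzRing.Build (endo V)
  endo_mulA endo_mul1l endo_mul1r endo_mulDl endo_mulDr.

End EndoRing.

(* vprod u n v is u(n)v. The library operator \sum_(i \in setT) is the sum    *)
(* over the support when the support is finite; vprod_trunc guarantees this   *)
(* for both sums of vprod_jacobi. The negative powers of -1 are taken in int, *)
(* where -1 is invertible.                                                    *)
HB.mixin Record Zmodule_isVertexRing V of GRing.Zmodule V := {
  vprod : V -> int -> V -> V;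
  vacuum : V;
  vprodDl : forall (n : int) (u u' v : V),
    vprod (u + u') n v = vprod u n v + vprod u' n v;
  vprodDr : forall (n : int) (u v v' : V),
    vprod u n (v + v') = vprod u n v + vprod u n v';
  vprod_trunc : forall u v : V,
    exists n0 : nat, forall n : int, n0%:Z <= n -> vprod u n v = 0;
  vprod_vacuumN1 : forall u : V, vprod u (-1) vacuum = u;
  vprod_vacuum_ge0 : forall (u : V) (n : int), 0 <= n -> vprod u n vacuum = 0;
  vprod_jacobi : forall (u v w : V) (r s t : int),
    \sum_(i \in [set: nat])
       vprod (vprod u (t + i%:Z) v) (r + s - i%:Z) w *~ binz r i
    = \sum_(i \in [set: nat])
       (vprod u (r + t - i%:Z) (vprod v (s + i%:Z) w)
        - vprod v (s + t - i%:Z) (vprod u (r + i%:Z) w) *~ ((-1) ^ t))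
         *~ ((-1) ^+ i * binz t i)
}.

#[short(type="vertexRingType")]
HB.structure Definition VertexRing :=
  { V of GRing.Zmodule V & Zmodule_isVertexRing V }.

Arguments vacuum {s}.

Section Modes.
Variable V : vertexRingType.

Fact vprod_nmod_morphism (u : V) (n : int) : nmod_morphism (vprod u n).
Proof.
split; last exact: vprodDr.
by apply: (@addIr _ (vprod u n 0)); rewrite -vprodDr !add0r.
Qed.
HB.instance Definition _ (u : V) (n : int) :=
  GRing.isNmodMorphism.Build V V (vprod u n) (vprod_nmod_morphism u n).

Definition mode (u : V) (n : int) : endo V := vprod u n.

Definition hs_fun (m : nat) (u : V) : V := vprod u (- m%:Z - 1) vacuum.

Fact hs_fun_nmod_morphism m : nmod_morphism (hs_fun m).
Proof.
split=> [|u v]; last exact: vprodDl.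
by apply: (@addIr _ (hs_fun m 0)); rewrite /hs_fun -vprodDl !add0r.
Qed.
HB.instance Definition _ (m : nat) :=
  GRing.isNmodMorphism.Build V V (hs_fun m) (hs_fun_nmod_morphism m).

(* The canonical Hasse-Schmidt derivation: D m is D_m. *)
Definition D (m : nat) : endo V := hs_fun m.

End Modes.
Arguments D {V} m.

(* Elements of End(V)[[z, z^-1]], indexed by modes: a n is the coefficient of *)
(* z^(-n-1). The copy restricts the pointwise structures on functions to the  *)
(* additive one.                                                              *)
Definition endo_series (V : zmodType) : Type := int -> endo V.
HB.instance Definition _ (V : zmodType) :=
  GRing.Zmodule.copy (endo_series V) (int -> endo V).

Section EndoSeries.
Variable V : zmodType.
Implicit Types (a : endo_series V) (f : endo V).

(* delta^(i) sends the term a(k) z^(-k-1) to binz (-k-1) i a(k) z^(-k-i-1), so *)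
(* its coefficient of z^(-n-1) comes from k = n - i.                          *)
Definition delta (i : nat) a : endo_series V :=
  fun n => let k := n - i%:Z in a k *~ binz (- k - 1) i.

Definition series_mulr a f : endo_series V := fun n => a n * f.

Definition series_comm f a : endo_series V := fun n => f * a n - a n * f.

End EndoSeries.

Definition Y (V : vertexRingType) (u : V) : endo_series V := mode u.

(* Main.v *)
(* The case r = 0 of the Jacobi identity is an associativity formula for
   (u(t)v)(s)w, and the case t = 0, v = 1 says that the modes of the vacuum
   commute with all modes. Together with the creation axiom they force
   1(n) = 0 for n <> -1 and 1(-1) = Id, which contains (a). Then (b) is the
   associativity formula for v = 1, t = -m-1, where at most one term survives,
   and (c) is the one for D_m(u(n)w) = (u(n)w)(-m-1)1. *)
Require Import Defs.
From HB Require Import structures.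
From mathcomp Require Import all_boot all_order all_algebra.
From mathcomp Require Import boolp classical_sets functions fsbigop.
From mathcomp Require Import zify.

Set Implicit Arguments.
Unset Strict Implicit.
Unset Printing Implicit Defensive.

Import GRing.Theory.
Local Open Scope ring_scope.

Lemma prod_sub_nat (n k : nat) :
  \prod_(i < k) (n%:Z - i%:Z) = (n ^_ k)%:Z.
Proof.
elim: k => [|k IHk]; first by rewrite big_ord0 ffactn0.
rewrite big_ord_recr /= IHk ffactnSr PoszM.
have [lenk|ltnk] := leqP k n; first by rewrite subzn.
by rewrite ffact_small // !mul0r.
Qed.

Lemma prod_sub_reflect (m : int) (k : nat) :
  \prod_(i < k) (k%:Z - m - 1 - i%:Z) = (-1) ^+ k * \prod_(i < k) (m - i%:Z).
Proof.
rewrite (reindex_inj rev_ord_inj) /= -[in (-1) ^+ k](card_ord k) -prodrN.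
by apply: eq_bigr => i _; have := ltn_ord i; lia.
Qed.

Lemma binz_0 (m : int) : binz m 0 = 1.
Proof. by rewrite /binz big_ord0. Qed.

Lemma binz_nat (n k : nat) : binz n k = 'C(n, k).
Proof.
by rewrite /binz prod_sub_nat -bin_ffact PoszM mulzK // eqz_nat -lt0n fact_gt0.
Qed.

(** The reflection m -> k - m - 1 sends a negative [m] to a natural number and changes the product
    only by the sign (-1)^k, so falling factorials of natural numbers suffice. *)
Lemma dvdz_fact_prod (m : int) (k : nat) :
  ((k`!)%:Z %| \prod_(i < k) (m - i%:Z))%Z.
Proof.
have fact_dvd (n : nat) : ((k`!)%:Z %| (n ^_ k)%:Z)%Z.
  by rewrite -bin_ffact PoszM dvdz_mull.
case: m => n; first by rewrite prod_sub_nat.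
rewrite -[X in (_ %| X)%Z](signrMK k) -prod_sub_reflect.
rewrite (_ : \prod_(i < k) _ = \prod_(i < k) ((k + n)%:Z - i%:Z)); last first.
  by apply: eq_bigr => i _; lia.
by rewrite prod_sub_nat dvdz_mull.
Qed.

Lemma binz_reflect (m : int) (k : nat) :
  binz (k%:Z - m - 1) k = (-1) ^+ k * binz m k.
Proof. by rewrite /binz prod_sub_reflect -mulz_divA ?dvdz_fact_prod. Qed.

Lemma binz_neg (n k : nat) :
  binz (- n%:Z - 1) k = (-1) ^+ k * ('C(n + k, k))%:Z.
Proof. by rewrite -binz_nat -binz_reflect; congr binz; lia. Qed.

Lemma endo_mulrzE (V : zmodType) (f : endo V) (z : int) (x : V) :
  (f *~ z) x = f x *~ z.
Proof.
have endo_mulrnE n : (f *+ n) x = f x *+ n.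
  by elim: n => [//|n IHn]; rewrite !mulrS -IHn.
by case: z => n; rewrite ?NegzE ?mulrNz -!pmulrn -endo_mulrnE.
Qed.

Lemma endo_series_sumE (V : zmodType) (I : Type) (r : seq I)
    (F : I -> endo_series V) (n : int) (x : V) :
  (\sum_(i <- r) F i) n x = \sum_(i <- r) F i n x.
Proof. exact: (big_morph (fun a : endo_series V => a n x)). Qed.

Lemma fsbig_setT_ord (V : zmodType) (n : nat) (F : nat -> V) :
  (forall i, (n <= i)%N -> F i = 0) ->
  \sum_(i \in [set: nat]) F i = \sum_(i < n) F i.
Proof.
move=> F0; rewrite (fsbigE (index_iota 0 n)) ?iota_uniq //; last first.
  by move=> i _; rewrite mem_index_iota /= -leqNgt; exact: F0.
by rewrite -(big_mkord xpredT); apply: eq_bigl => i; rewrite in_setT.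
Qed.

Lemma fsbig_setT_single (V : zmodType) (k : nat) (F : nat -> V) :
  (forall i, i != k -> F i = 0) -> \sum_(i \in [set: nat]) F i = F k.
Proof.
move=> F0; rewrite (fsbigE [:: k]) ?big_cons ?big_nil ?in_setT /= ?addr0 //.
by move=> i _; rewrite inE; exact: F0.
Qed.

Section VertexRing.
Variable V : vertexRingType.
Implicit Types (u v w : V) (s t n : int) (m k : nat).

Lemma vprodr0 u n : vprod u n 0 = 0. Proof. exact: raddf0. Qed.

Lemma vprod0r u n : vprod 0 n u = 0.
Proof. by apply: (addIr (vprod 0 n u)); rewrite -vprodDl !add0r. Qed.

Lemma vprod_assoc u v w t s :
  vprod (vprod u t v) s w =
  \sum_(i \in [set: nat])
     (vprod u (t - i%:Z) (vprod v (s + i%:Z) w)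
      - vprod v (s + t - i%:Z) (vprod u i%:Z w) *~ ((-1) ^ t))
       *~ ((-1) ^+ i * binz t i).
Proof.
have := vprod_jacobi u v w 0 s t.
rewrite (fsbig_setT_single (k := 0)) => [|[//|i] _]; last first.
  by rewrite (binz_nat 0) bin0n.
rewrite binz_0 mulr1z addr0 add0r subr0 => ->.
by apply: eq_fsbigr => i _; rewrite !add0r.
Qed.

(** For v = 1 and t = 0 the left side of the Jacobi identity vanishes, as u(i)1 = 0 for i >= 0, and
    only the commutator at i = 0 remains on the right. *)
Lemma vprod_vacuum_comm u w n s :
  vprod u n (vprod vacuum s w) = vprod vacuum s (vprod u n w).
Proof.
have := vprod_jacobi u vacuum w n s 0.
rewrite fsbig1 => [|i _]; last by rewrite add0r vprod_vacuum_ge0 // vprod0r mul0rz.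
rewrite (fsbig_setT_single (k := 0)) => [|[//|i] _]; last first.
  by rewrite (binz_nat 0) bin0n mulr0.
rewrite binz_0 expr0 expr0z !mulr1z !addr0.
by move/esym/subr0_eq.
Qed.

(* For s <= -2 expand (1(-1)1)(s)1 by associativity. By induction only the
   terms 1(-1)1(s)1 and 1(s)1(-1)1 survive; each equals 1(s)1, as does the
   left-hand side, so 1(s)1 = 0. *)
Lemma vprod_vacuum_vacuum s : s != -1 -> vprod vacuum s vacuum = 0 :> V.
Proof.
have vac_neg k : vprod vacuum (- k%:Z - 2) vacuum = 0 :> V.
  elim/ltn_ind: k => k IHk.
  have := vprod_assoc vacuum vacuum vacuum (-1) (- k%:Z - 2).
  rewrite (fsbig_setT_ord (n := k.+2)) => [|i lei]; last first.
    by rewrite !vprod_vacuum_ge0 ?(vprodr0, mul0rz, subr0) //; lia.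
  (* Every coefficient (-1)^i [binz] (-1) i equals 1. *)
  under eq_bigr => i _ do rewrite (vprod_vacuum_ge0 _ i%:Z) // vprodr0 mul0rz
    subr0 (binz_neg 0) add0n binn mulr1 -expr2 sqrr_sign mulr1z.
  rewrite big_ord_recl big_ord_recr big1 /= ?add0r => [|i _]; last first.
    have ltik := ltn_ord i; rewrite /bump /= add1n.
    rewrite (_ : - k%:Z - 2 + i.+1%:Z = - (k - i.+1)%N%:Z - 2).
      by rewrite IHk ?vprodr0 //; lia.
    by lia.
  rewrite vprod_vacuum_comm !addr0 /bump /= add1n.
  rewrite (_ : - k%:Z - 2 + k.+1%:Z = -1); last by lia.
  rewrite (_ : - 1 - k.+1%:Z = - k%:Z - 2); last by lia.
  by rewrite !vprod_vacuumN1 -[LHS]addr0 => /addrI.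
case: s => [s _|[|k] //]; first by rewrite vprod_vacuum_ge0.
by move=> _; rewrite -[RHS](vac_neg k); congr vprod; lia.
Qed.

(** Write w = w(-1)1 and move 1(n) past w(-1): the value is w(-1)1(n)1. *)
Lemma vprod_vacuumE n w : vprod vacuum n w = if n == -1 then w else 0.
Proof.
rewrite -[w in LHS](vprod_vacuumN1 w) -vprod_vacuum_comm.
case: eqP => [->|/eqP nN1]; first by rewrite !vprod_vacuumN1.
by rewrite vprod_vacuum_vacuum ?vprodr0.
Qed.

Lemma hs_vacuum m : (0 < m)%N -> D m (vacuum : V) = 0.
Proof.
by move=> m_gt0; rewrite /D /= /hs_fun vprod_vacuum_vacuum //; lia.
Qed.

(** The vacuum modes leave only i = -s - 1 in the first half of the sum and i = s - m in the second;
    as i >= 0, these need s < 0 and s >= m respectively. *)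
Lemma mode_hs u m : Y (D m u) = delta m (Y u).
Proof.
apply: funext => s; apply: endoP => w.
rewrite /delta endo_mulrzE /Y /mode /D /= /hs_fun vprod_assoc.
have signN1 : (-1) ^ (- m%:Z - 1) = (-1) ^+ m.+1 :> int.
  by rewrite expN1r; congr ((-1) ^+ _); lia.
(* The signs cancel, so term i has coefficient C(m + i, i). *)
rewrite signN1; under eq_fsbigr do rewrite binz_neg signrMK !vprod_vacuumE.
have [s_lt0|s_ge0] := boolP (s < 0).
  set k := `|(s + 1)%R|%N.
  rewrite (fsbig_setT_single (k := k)) => [|i nik]; last first.
    by rewrite !ifF ?vprodr0 ?mul0rz ?subrr ?mul0rz //; lia.
  rewrite ifT ?ifF; try lia.
  rewrite mul0rz subr0 (_ : - (s - m%:Z) - 1 = (m + k)%N); last by lia.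
  rewrite binz_nat -bin_sub ?leq_addl // addnK; congr (vprod u _ w *~ _); lia.
have [s_ltm|s_gem] := boolP (s < m%:Z).
  (* No term survives, and the coefficient in [delta] is 0 because 0 <= m - s - 1 < m. *)
  rewrite fsbig1 => [|i _]; last first.
    by rewrite !ifF ?vprodr0 ?mul0rz ?subrr ?mul0rz //; lia.
  rewrite (_ : - (s - m%:Z) - 1 = `|(m%:Z - s - 1)%R|%N); last by lia.
  by rewrite binz_nat bin_small ?mulr0z //; lia.
set k := `|(s - m%:Z)%R|%N.
rewrite (fsbig_setT_single (k := k)) => [|i nik]; last first.
  by rewrite !ifF ?vprodr0 ?mul0rz ?subrr ?mul0rz //; lia.
rewrite ifF ?ifT; try lia.
rewrite vprodr0 sub0r (_ : s - m%:Z = k); last by lia.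
(* The minus sign of the second half times (-1)^(m+1) gives the sign (-1)^m of [binz] (-k - 1) m. *)
rewrite binz_neg (addnC k) -[in LHS]bin_sub ?leq_addl // addnK.
by rewrite -mulrNz -mulrzA exprS mulN1r opprK.
Qed.

(** In the expansion of (u(n)w)(-m-1)1 the second half vanishes by u(i)1 = 0, and the first half
    consists of multiples of u(n-i)D_{m-i}w for i <= m. *)
Lemma hs_commutator u m :
  series_comm (D m) (Y u) =
    \sum_(1 <= i < m.+1) series_mulr (delta i (Y u)) (D (m - i)%N).
Proof.
apply: funext => n; apply: endoP => w.
rewrite endo_series_sumE.
have -> : series_comm (D m) (Y u) n w =
    vprod (vprod u n w) (- m%:Z - 1) vacuum
    - vprod u n (vprod w (- m%:Z - 1) vacuum) by [].
rewrite vprod_assoc (fsbig_setT_ord (n := m.+1)) => [|i lti]; last first.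
  by rewrite !vprod_vacuum_ge0 ?(vprodr0, mul0rz, subr0) //; lia.
(* The term i = 0 is u(n)D_m w, which the commutator subtracts. *)
rewrite big_ord_recl /= (vprod_vacuum_ge0 u 0) // vprodr0 mul0rz !subr0.
rewrite binz_0 mulr1 mulr1z addrC addKr big_add1 big_mkord.
apply: eq_bigr => i _; have ltim := ltn_ord i.
have -> : delta i.+1 (Y u) n (hs_fun (m - i.+1) w) =
    vprod u (n - i.+1%:Z) (hs_fun (m - i.+1) w) *~ binz (- (n - i.+1%:Z) - 1) i.+1.
  exact: endo_mulrzE.
rewrite /bump /= add1n (vprod_vacuum_ge0 u i.+1) // vprodr0 mul0rz subr0.
(* Reflection turns (-1)^i [binz] n i into the coefficient [binz] (i - n - 1) i of [delta]. *)
rewrite -binz_reflect /hs_fun.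
by congr (vprod u _ (vprod w _ vacuum) *~ binz _ _); lia.
Qed.

End VertexRing.

Theorem theorem3p10 (V : vertexRingType) (u : V) (m : nat) (m_ge1 : (1 <= m)%N) :
  [/\ D m (vacuum : V) = 0,
      Y (D m u) = delta m (Y u)
    & series_comm (D m) (Y u) =
        \sum_(1 <= i < m.+1) series_mulr (delta i (Y u)) (D (m - i)%N)].
Proof. by split; [exact: hs_vacuum | exact: mode_hs | exact: hs_commutator]. Qed.
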